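(* Let $m\ge 1$, $I:=\{1,2,\dots,m\}$, let $T_i:\mathcal H\to\mathcal H$ be an $\alpha_i$-demicontraction, where $\alpha_i\in(-\infty,1)$, $i\in I$, and suppose $\bigcap_{i=1}^m\operatorname{Fix}T_i\ne\emptyset$. Let $w_i>0$, $i\in I$, with $\sum_{i=1}^m w_i=1$, and let $T:=\sum_{i=1}^m w_iT_i$. Then: (i) $T$ is an $\alpha$-demicontraction with $$\alpha=1-\left(\sum_{i=1}^m\frac{w_i}{1-\alpha_i}\right)^{-1};$$ (ii) $-\infty<\min_{i\in I}\alpha_i\le\alpha\le\max_{i\in I}\alpha_i<1$; (iii) $\operatorname{Fix}T=\bigcap_{i=1}^m\operatorname{Fix}T_i$; (iv) if every $T_i$, $i\in I$, satisfies the demi closedness principle, then $T$ also satisfies the demi closedness principle.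
   Context: $\mathcal H$ is a real Hilbert space with $\mathcal H\neq\{0\}$. For $T:\mathcal H\to\mathcal H$, $\operatorname{Fix}T:=\{z\in\mathcal H: T(z)=z\}$. For $\alpha\in(-\infty,1)$, an operator $T$ with $\operatorname{Fix}T\neq\emptyset$ is an $\alpha$-demicontraction if $\|T(x)-z\|^2\le\|x-z\|^2+\alpha\|T(x)-x\|^2$ for all $x\in\mathcal H$ and $z\in\operatorname{Fix}T$. An operator $T$ satisfies the demi closedness principle if for any bounded sequence $\{x^k\}$ with $\|T(x^k)-x^k\|\to0$, every weak cluster point $y$ of $\{x^k\}$ belongs to $\operatorname{Fix}T$. *)

(* Defs.v *)
From HB Require Import structures.
From mathcomp Require Export all_boot all_order all_algebra sesquilinear.
From mathcomp Require Export all_classical all_reals all_analysis.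
Export Order.TTheory GRing.Theory Num.Theory.
Export numFieldNormedType.Exports.

#[export] Set Implicit Arguments.
#[export] Unset Strict Implicit.
#[export] Unset Printing Implicit Defensive.

Local Open Scope classical_set_scope.
Local Open Scope ring_scope.

(* A real Hilbert space is a complete normed module H over R : realType together
   with a positive definite symmetric bilinear form dot : {dot H for idfun} that
   induces the norm. *)
Definition induces_norm (R : realType) (H : completeNormedModType R)
    (dot : {dot H for idfun}) : Prop :=
  forall x : H, `|x| ^+ 2 = dot x x.

Definition fixed_points (H : Type) (T : H -> H) : set H := [set z | T z = z].

Definition demicontraction (R : realType) (H : normedModType R) (alpha : R)
    (T : H -> H) : Prop :=
  [/\ alpha < 1, fixed_points T !=set0
    & forall x z : H, fixed_points T z ->
        `|T x - z| ^+ 2 <= `|x - z| ^+ 2 + alpha * `|T x - x| ^+ 2].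

Definition weakly_cvg (R : realType) (H : completeNormedModType R)
    (dot : {dot H for idfun}) (x : nat -> H) (y : H) : Prop :=
  forall v : H, (fun k => dot (x k) v : R) @ \oo --> (dot y v : R).

(* Clustering is along subsequences; for bounded sequences in a Hilbert space
   this agrees with clustering in the weak topology. *)
Definition weak_cluster_point (R : realType) (H : completeNormedModType R)
    (dot : {dot H for idfun}) (x : nat -> H) (y : H) : Prop :=
  exists2 phi : nat -> nat, increasing_seq phi & weakly_cvg dot (x \o phi) y.

Definition demiclosedness_principle (R : realType)
    (H : completeNormedModType R) (dot : {dot H for idfun})
    (T : H -> H) : Prop :=
  forall x : nat -> H, bounded_fun x ->
    (fun k => `|T (x k) - x k|) @ \oo --> (0 : R) ->
    forall y : H, weak_cluster_point dot x y -> fixed_points T y.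

(* Main.v *)
Require Import Defs.
From mathcomp Require Import ring lra.

(** In terms of the displacement [d = T x - x], being an [alpha]-demicontraction
    says that [(1 - alpha) |d|^2 <= - 2 <x - z, d>] for every fixed point [z]
    ([demi_ineqE]).  The right-hand side is linear in [d].  Hence, if [z] is a
    common fixed point of the [T_ i], averaging with the weights [w i] gives
    [\sum_i w i (1 - alpha_ i) |d_i|^2 <= - 2 <x - z, d>]
    where [d_i = T_ i x - x] and [d = \sum_i w i d_i] is the displacement of the
    averaged operator ([sum_displacement_le]).  All the claims about operators
    follow from this inequality.

    - If [d = 0], all the nonnegative terms on the left vanish, so that every
      [d_i] is [0]: a fixed point of the average is a common fixed point.
    - The weighted Cauchy-Schwarz inequality
      [|d|^2 <= (\sum_i w i / (1 - alpha_ i)) (\sum_i w i (1 - alpha_ i) |d_i|^2)]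
      turns it into the inequality of an [alpha]-demicontraction, [1 - alpha]
      being the inverse of the first factor.
    - Along a bounded sequence with [|d| --> 0], the right-hand side tends to
      [0], so that each [|d_i|] tends to [0] and the demiclosedness principle of
      each [T_ i] applies to the same sequence.

    The bounds on [alpha] hold because [1 - alpha] is the weighted harmonic mean
    of the numbers [1 - alpha_ i]. *)

Local Open Scope classical_set_scope.
Local Open Scope ring_scope.

Definition weighted_average (R : realType) (V : lmodType R) (I : finType)
    (w : I -> R) (T_ : I -> V -> V) (x : V) : V := \sum_i w i *: T_ i x.

Lemma weighted_averageB (R : realType) (V : lmodType R) (I : finType)
    (w : I -> R) (T_ : I -> V -> V) (x : V) :
  \sum_i w i = 1 ->
  weighted_average w T_ x - x = \sum_i w i *: (T_ i x - x).
Proof.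
move=> w1; under eq_bigr do rewrite scalerBr.
by rewrite sumrB -scaler_suml w1 scale1r.
Qed.

Lemma weighted_average_fixed (R : realType) (V : lmodType R) (I : finType)
    (w : I -> R) (T_ : I -> V -> V) (z : V) :
  \sum_i w i = 1 -> (forall i, fixed_points (T_ i) z) ->
  fixed_points (weighted_average w T_) z.
Proof.
move=> w1 Tz; apply/subr0_eq; rewrite weighted_averageB// big1// => i _.
by rewrite Tz subrr scaler0.
Qed.

Lemma dotC (R : realType) (H : completeNormedModType R)
    (dot : {dot H for idfun}) (x y : H) : dot x y = dot y x.
Proof. by rewrite (hermC dot) /= expr0 mul1r. Qed.

Lemma sqr_normD (R : realType) (H : completeNormedModType R)
    (dot : {dot H for idfun}) (dot_norm : induces_norm dot) (x y : H) :
  `|x + y| ^+ 2 = `|x| ^+ 2 + 2 * dot x y + `|y| ^+ 2.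
Proof.
rewrite !dot_norm linearDl !linearDr /= (dotC dot y x); ring.
Qed.

(** Cauchy-Schwarz, read off from the triangle inequality. *)
Lemma dot_le_norm (R : realType) (H : completeNormedModType R)
    (dot : {dot H for idfun}) (dot_norm : induces_norm dot) (x y : H) :
  dot x y <= `|x| * `|y|.
Proof.
have : `|x + y| ^+ 2 <= (`|x| + `|y|) ^+ 2.
  by rewrite ler_sqr ?nnegrE ?addr_ge0// ler_normD.
rewrite (sqr_normD dot_norm) sqrrD; lra.
Qed.

Lemma demi_ineqE (R : realType) (H : completeNormedModType R)
    (dot : {dot H for idfun}) (dot_norm : induces_norm dot)
    (alpha : R) (x y z : H) :
  (`|y - z| ^+ 2 <= `|x - z| ^+ 2 + alpha * `|y - x| ^+ 2)
  = ((1 - alpha) * `|y - x| ^+ 2 <= - 2 * dot (x - z) (y - x)).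
Proof.
have -> : y - z = (x - z) + (y - x) by rewrite [RHS]addrC addrA subrK.
by rewrite (sqr_normD dot_norm); apply/idP/idP; lra.
Qed.

(** Expand [0 <= \sum_i w i * c i * |d i - (t / c i) *: D|^2], where [D] is the
    weighted sum of the [d i], at the minimizing [t], which is the inverse of
    [\sum_i w i / c i]. *)
Lemma weighted_cauchy_schwarz (R : realType) (H : completeNormedModType R)
    (dot : {dot H for idfun}) (dot_norm : induces_norm dot) (I : finType)
    (w c : I -> R) (d : I -> H) :
  (forall i, 0 <= w i) -> (forall i, 0 < c i) ->
  (\sum_i w i / c i)^-1 * `|\sum_i w i *: d i| ^+ 2
    <= \sum_i w i * c i * `|d i| ^+ 2.
Proof.
move=> w0 c0; set S := \sum_i w i / c i; set D := \sum_i w i *: d i.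
set Q := \sum_i _.
have key (t : R) : 0 <= Q - 2 * t * `|D| ^+ 2 + t ^+ 2 * S * `|D| ^+ 2.
  have -> : Q - 2 * t * `|D| ^+ 2 + t ^+ 2 * S * `|D| ^+ 2
      = \sum_i w i * c i * `|d i + (- (t / c i)) *: D| ^+ 2.
    rewrite [in 2 * t * _]dot_norm {1}/D linear_sumlz mulr_sumr.
    rewrite /S mulr_sumr mulr_suml /Q -sumrB -big_split /=.
    apply: eq_bigr => i _; have ci0 : c i != 0 by rewrite gt_eqF.
    rewrite (sqr_normD dot_norm) (linearZr_LR dot) (linearZl_LR dot) /= normrZ exprMn.
    by rewrite real_normK ?num_real//; field.
  by apply: sumr_ge0 => i _; rewrite !mulr_ge0 ?sqr_ge0// ltW.
have := key S^-1.
have -> : S^-1 ^+ 2 * S = S^-1.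
  have [->|S0] := eqVneq S 0; first by rewrite mulr0 invr0.
  by rewrite expr2 mulfVK.
lra.
Qed.

Lemma sum_displacement_le (R : realType) (H : completeNormedModType R)
    (dot : {dot H for idfun}) (dot_norm : induces_norm dot) (I : finType)
    (w alpha_ : I -> R) (T_ : I -> H -> H) (x z : H) :
  (forall i, 0 <= w i) -> \sum_i w i = 1 ->
  (forall i, demicontraction (alpha_ i) (T_ i)) ->
  (forall i, fixed_points (T_ i) z) ->
  \sum_i w i * (1 - alpha_ i) * `|T_ i x - x| ^+ 2
    <= - 2 * dot (x - z) (weighted_average w T_ x - x).
Proof.
move=> w0 w1 T_demi Tz; rewrite weighted_averageB// linear_sumr mulr_sumr.
apply: ler_sum => i _; rewrite (linearZr_LR dot) /= [leRHS]mulrCA -[leLHS]mulrA.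
rewrite ler_wpM2l// -(demi_ineqE dot_norm).
by case: (T_demi i) => _ _; apply.
Qed.

Lemma fixed_points_weighted_average (R : realType)
    (H : completeNormedModType R) (dot : {dot H for idfun})
    (dot_norm : induces_norm dot) (I : finType) (w alpha_ : I -> R)
    (T_ : I -> H -> H) :
  (forall i, 0 < w i) -> \sum_i w i = 1 ->
  (forall i, demicontraction (alpha_ i) (T_ i)) ->
  \bigcap_(i in [set: I]) fixed_points (T_ i) !=set0 ->
  fixed_points (weighted_average w T_)
    = \bigcap_(i in [set: I]) fixed_points (T_ i).
Proof.
move=> w0 w1 T_demi [z Tz]; apply/seteqP; split => [x Tx i _|x Tx]; last first.
  by apply: weighted_average_fixed => // i; exact: Tx.
have c0 j : 0 < w j * (1 - alpha_ j).
  by rewrite mulr_gt0// subr_gt0; case: (T_demi j).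
have t0 j : 0 <= w j * (1 - alpha_ j) * `|T_ j x - x| ^+ 2.
  by rewrite mulr_ge0 ?sqr_ge0// ltW.
have := @sum_displacement_le _ _ dot dot_norm _ w alpha_ T_ x z
  (fun j => ltW (w0 j)) w1 T_demi (fun j => Tz j Logic.I).
rewrite Tx subrr linear0r mulr0 => le0.
have /eqP : \sum_j w j * (1 - alpha_ j) * `|T_ j x - x| ^+ 2 = 0.
  by apply/eqP; rewrite eq_le le0 sumr_ge0.
rewrite psumr_eq0// => /allP/(_ i (mem_index_enum _)) /=.
rewrite mulf_eq0 gt_eqF//= sqrf_eq0 normr_eq0 subr_eq0 => /eqP; exact.
Qed.

Lemma demicontraction_weighted_average (R : realType)
    (H : completeNormedModType R) (dot : {dot H for idfun})
    (dot_norm : induces_norm dot) (I : finType) (w alpha_ : I -> R)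
    (T_ : I -> H -> H) :
  (forall i, 0 < w i) -> \sum_i w i = 1 ->
  (forall i, demicontraction (alpha_ i) (T_ i)) ->
  \bigcap_(i in [set: I]) fixed_points (T_ i) !=set0 ->
  demicontraction (1 - (\sum_i w i / (1 - alpha_ i))^-1)
    (weighted_average w T_).
Proof.
move=> w0 w1 T_demi fix0.
have FixT := fixed_points_weighted_average dot_norm w0 w1 T_demi fix0.
have c0 i : 0 < 1 - alpha_ i by rewrite subr_gt0; case: (T_demi i).
have t0 i : 0 < w i / (1 - alpha_ i) by rewrite divr_gt0.
split; last 1 first.
- move=> x z; rewrite FixT => Tz; rewrite (demi_ineqE dot_norm) subKr.
  apply: le_trans (@sum_displacement_le _ _ dot dot_norm _ w alpha_ T_ x z
    (fun j => ltW (w0 j)) w1 T_demi (fun j => Tz j Logic.I)).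
  rewrite weighted_averageB//.
  by apply: (weighted_cauchy_schwarz dot_norm) => // i; exact: ltW.
- rewrite gtrBl invr_gt0 lt_def sumr_ge0 ?andbT => [|i _]; last exact: ltW.
  apply/negP; rewrite psumr_eq0 => [/allP t_eq0|i _]; last exact: ltW.
  (* Were the sum zero, the index type would be empty, against the weights
     having sum [1]. *)
  move: w1; rewrite big1 => [/esym/eqP|i _]; first by rewrite oner_eq0.
  by have := t_eq0 i (mem_index_enum _); rewrite /= gt_eqF.
- by rewrite FixT.
Qed.

Lemma demiclosedness_weighted_average (R : realType)
    (H : completeNormedModType R) (dot : {dot H for idfun})
    (dot_norm : induces_norm dot) (I : finType) (w alpha_ : I -> R)
    (T_ : I -> H -> H) :
  (forall i, 0 < w i) -> \sum_i w i = 1 ->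
  (forall i, demicontraction (alpha_ i) (T_ i)) ->
  \bigcap_(i in [set: I]) fixed_points (T_ i) !=set0 ->
  (forall i, demiclosedness_principle dot (T_ i)) ->
  demiclosedness_principle dot (weighted_average w T_).
Proof.
move=> w0 w1 T_demi [z Tz] T_dcl x x_bnd d0 y xy.
have c0 j : 0 < w j * (1 - alpha_ j).
  by rewrite mulr_gt0// subr_gt0; case: (T_demi j).
apply: weighted_average_fixed => // i; apply: (T_dcl i x x_bnd _ y xy).
have [M xM] : exists M : R, forall k, `|x k| <= M.
  case: x_bnd => M [_ /(_ (M + 1))]; rewrite ltrDl ltr01 => /(_ isT) xM.
  by exists (M + 1) => k; exact: xM.
set d := fun k => weighted_average w T_ (x k) - x k.
pose K := 2 * (M + `|z|) / (w i * (1 - alpha_ i)).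
have le_d k : `|T_ i (x k) - x k| ^+ 2 <= K * `|d k|.
  rewrite /K mulrAC ler_pdivlMr// mulrC.
  apply: (@le_trans _ _ (- 2 * dot (x k - z) (d k))).
    apply: le_trans (@sum_displacement_le _ _ dot dot_norm _ w alpha_ T_ _ z
      (fun j => ltW (w0 j)) w1 T_demi (fun j => Tz j Logic.I)).
    rewrite (bigD1 i)//= lerDl sumr_ge0// => j _.
    by rewrite mulr_ge0 ?sqr_ge0// ltW.
  rewrite mulNr -mulrN -(linearNr dot) -mulrA ler_pM2l//.
  apply: le_trans (dot_le_norm dot_norm _ _) _.
  rewrite normrN ler_wpM2r// (le_trans (ler_normB _ _))// lerD2r; exact: xM.
have sqr0 : (fun k => `|T_ i (x k) - x k| ^+ 2) @ \oo --> (0 : R).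
  apply: (@squeeze_cvgr _ _ _ _ (fun=> 0) (fun k => K * `|d k|)).
  - by near=> k; rewrite sqr_ge0 le_d.
  - exact: cvg_cst.
  - rewrite -(mulr0 K); apply: cvgM => //; exact: cvg_cst.
have -> : (fun k => `|T_ i (x k) - x k|)
    = (fun k => Num.sqrt (`|T_ i (x k) - x k| ^+ 2)).
  by apply/funext => k; rewrite sqrtr_sqr normr_id.
have := continuous_cvg (h := Num.sqrt) _ (@sqrt_continuous R 0) sqr0.
by rewrite sqrtr0; apply.
Unshelve. all: by end_near. Qed.

(** The inverse is the weighted harmonic mean of the [1 - alpha_ i]. *)
Lemma harmonic_mean_bounds (R : realType) (I : finType)
    (w alpha_ : I -> R) (a b : R) :
  (forall i, 0 <= w i) -> \sum_i w i = 1 -> b < 1 ->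
  (forall i, a <= alpha_ i <= b) ->
  a <= 1 - (\sum_i w i / (1 - alpha_ i))^-1 <= b.
Proof.
move=> w0 w1 b1 ab.
have c0 i : 0 < 1 - alpha_ i by have /andP[_] := ab i; lra.
have b0 : 0 < 1 - b by lra.
have [a1|a1] := ltP a 1; last first.
  (* Then [I] is empty, which the weights exclude. *)
  move: w1; rewrite big1 => [/esym/eqP|i _]; first by rewrite oner_eq0.
  by have := ab i; have := c0 i; move=> ? /andP[]; lra.
have a0 : 0 < 1 - a by lra.
set S := \sum_i _.
have Sa : (1 - a)^-1 <= S.
  rewrite -[leLHS]mul1r -w1 mulr_suml ler_sum// => i _.
  rewrite ler_wpM2l// lef_pV2 ?posrE//; have /andP[] := ab i; lra.
have Sb : S <= (1 - b)^-1.
  rewrite -[leRHS]mul1r -w1 mulr_suml ler_sum// => i _.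
  rewrite ler_wpM2l// lef_pV2 ?posrE//; have /andP[] := ab i; lra.
have S0 : 0 < S by apply: lt_le_trans Sa; rewrite invr_gt0.
have : S^-1 <= 1 - a by rewrite -[leRHS]invrK lef_pV2 ?posrE ?invr_gt0.
have : 1 - b <= S^-1 by rewrite -[leLHS]invrK lef_pV2 ?posrE ?invr_gt0.
by move=> ? ?; apply/andP; split; lra.
Qed.

Theorem corollary3p4 (R : realType) (H : completeNormedModType R)
    (dot : {dot H for idfun}) (dot_norm : induces_norm dot)
    (H_neq0 : exists x : H, x != 0)
    (m : nat) (m_ge1 : (1 <= m)%N)
    (T_ : 'I_m -> H -> H) (alpha_ : 'I_m -> R)
    (alpha_lt1 : forall i, alpha_ i < 1)
    (T_demi : forall i, demicontraction (alpha_ i) (T_ i))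
    (fix_neq0 : \bigcap_(i in [set: 'I_m]) fixed_points (T_ i) !=set0)
    (w : 'I_m -> R) (w_gt0 : forall i, 0 < w i)
    (w_sum1 : \sum_(i < m) w i = 1) :
  let T : H -> H := fun x => \sum_(i < m) w i *: T_ i x in
  let alpha : R := 1 - (\sum_(i < m) w i / (1 - alpha_ i))^-1 in
  let i0 : 'I_m := Ordinal m_ge1 in
  let alpha_min : R := \big[Num.min/alpha_ i0]_(i < m) alpha_ i in
  let alpha_max : R := \big[Num.max/alpha_ i0]_(i < m) alpha_ i in
  [/\ demicontraction alpha T,
      [/\ (-oo < alpha_min%:E)%E, alpha_min <= alpha, alpha <= alpha_max
        & alpha_max < 1],
      fixed_points T = \bigcap_(i in [set: 'I_m]) fixed_points (T_ i)
    & (forall i, demiclosedness_principle dot (T_ i)) ->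
      demiclosedness_principle dot T].
Proof.
move=> T alpha i0 alpha_min alpha_max.
have max_lt1 : alpha_max < 1 by apply: bigmax_lt.
have /andP[le_alpha alpha_le] : alpha_min <= alpha <= alpha_max.
  apply: harmonic_mean_bounds => // i; first exact: ltW.
  by rewrite bigmin_le le_bigmax.
split.
- exact: (demicontraction_weighted_average dot_norm).
- by split; rewrite ?ltNyr.
- exact: (fixed_points_weighted_average dot_norm).
- exact: (demiclosedness_weighted_average dot_norm).
Qed.
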